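(* Let $m\ge 2$ be an integer. The set $$G=\{f_k^{(m)}(x): k\in\mathbb{Z}\}$$ is an infinite abelian group under multiplication modulo $\Psi_m(x)$.
   Context: For a positive integer $m$ let $\Psi_m(x)=\sum_{j=0}^{m-1}x^j$. For $m\ge2$ the polynomial $1-x$ is invertible modulo $\Psi_m(x)$ over $\mathbb{Q}$; for $k\in\mathbb{Z}$, $f_k^{(m)}(x)\in\mathbb{Q}[x]$ denotes the unique polynomial of degree less than $m-1$ congruent to $(1-x)^{-k}$ modulo $\Psi_m(x)$. Multiplication modulo $\Psi_m(x)$ means taking the product of two polynomials and then its remainder upon division by $\Psi_m(x)$. *)

(* Defs.v *)
From HB Require Import structures.
From mathcomp Require Import all_boot all_order all_algebra.
From mathcomp Require Import qpoly.
From mathcomp Require Import classical_sets cardinality.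

Set Implicit Arguments.
Unset Strict Implicit.
Unset Printing Implicit Defensive.
Import Order.TTheory GRing.Theory Num.Theory.
Local Open Scope ring_scope.

Definition Psi (m : nat) : {poly rat} := \sum_(j < m) 'X^j.

(* The canonical representative (of size at most m - 1, i.e. of degree less
   than m - 1) of the class (1 - x)^(-k) in Q[x]/(Psi m); `^` is integer
   exponentiation in the unit ring {poly %/ Psi m}.  It is meaningful only for
   1 < m, when {poly %/ Psi m} really is the quotient by Psi m (mk_monic_Psi)
   and 1 - x is a unit there (unit_1subX); see fpolyP. *)
Definition fpoly (m : nat) (k : int) : {poly rat} :=
  val (in_qpoly (Psi m) (1 - 'X) ^ (- k)).

Definition mulmod (m : nat) (p q : {poly rat}) : {poly rat} :=
  (p * q) %% Psi m.

Definition Gset (m : nat) : set {poly rat} := [set fpoly m k | k in setT]%classic.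

Record abelian_group_on (T : Type) (G : set T) (op : T -> T -> T) : Prop := {
  group_closed : forall x y, G x -> G y -> G (op x y);
  group_assoc : forall x y z, G x -> G y -> G z ->
    op x (op y z) = op (op x y) z;
  group_unit_inv : exists e, [/\ G e,
    (forall x, G x -> op e x = x /\ op x e = x) &
    (forall x, G x -> exists y, [/\ G y, op x y = e & op y x = e])];
  group_comm : forall x y, G x -> G y -> op x y = op y x
}.

Lemma Psi_poly m : Psi m = \poly_(j < m) 1.
Proof. by rewrite poly_def; apply: eq_bigr => j _; rewrite scale1r. Qed.

Lemma size_Psi m : size (Psi m) = m.
Proof.
case: m => [|m]; first by rewrite /Psi big_ord0 size_poly0.
by rewrite Psi_poly size_poly_eq // oner_neq0.
Qed.

Lemma mk_monic_Psi m : (1 < m)%N -> mk_monic (Psi m) = Psi m.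
Proof.
move=> m1; have mon : Psi m \is monic.
  rewrite monicE lead_coefE size_Psi Psi_poly coef_poly.
  by case: m m1 => [|m] //= _; rewrite ltnSn.
by rewrite /mk_monic size_Psi m1 mon.
Qed.

Lemma unit_1subX m : (1 < m)%N ->
  in_qpoly (Psi m) (1 - 'X) \is a GRing.unit.
Proof.
move=> m1; rewrite unfold_in /= mk_monic_Psi //.
rewrite -Pdiv.IdomainMonic.modpE; last first.
  by rewrite -[X in X \is monic](mk_monic_Psi m1) monic_mk_monic.
rewrite coprimep_modr -[1 - 'X]opprB -scaleN1r.
rewrite coprimepZr ?oppr_eq0 ?oner_eq0 // -polyC1 coprimep_XsubC /root /Psi horner_sum.
rewrite (eq_bigr (fun=> 1)) => [|j _]; last by rewrite hornerXn expr1n.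
by rewrite sumr_const card_ord pnatr_eq0 -lt0n (ltnW m1).
Qed.

(* fpoly m k is the unique polynomial of degree less than m - 1 that is
   congruent to (1 - x)^(-k) modulo Psi m. *)
Lemma fpolyP m k p : (1 < m)%N ->
  p = fpoly m k <->
  (size p < m)%N /\ in_qpoly (Psi m) p = in_qpoly (Psi m) (1 - 'X) ^ (- k).
Proof.
move=> m1; rewrite /fpoly; set q := _ ^ _.
have sE : size (mk_monic (Psi m)) = m by rewrite mk_monic_Psi ?size_Psi.
split=> [->|[sp <-]]; last by rewrite [RHS]in_qpoly_small ?sE.
have sq := size_mk_monic q; split; first exact: (leq_trans sq (eq_leq sE)).
exact/val_inj/in_qpoly_small.
Qed.

(* Main.v *)
Require Import Defs.
From HB Require Import structures.
From mathcomp Require Import all_boot all_order all_algebra.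
From mathcomp Require Import classical_sets cardinality.
From mathcomp Require Import functions qpoly.

(** Powers of the unit [1 - x] multiply by adding exponents, so [G] is the image
    of [Z] and the group axioms are immediate.  It is infinite because [1 - x]
    has infinite order: if [(1 - x)^n = 1] modulo [Psi_m] with [n > 0], then,
    [Psi_m] being monic with integer coefficients, [(1 - x)^n = 1 + Psi_m q] with
    [q] in [Z[x]], and evaluating at [x = 1] shows that [m] divides [1]. *)

Import GRing.Theory.
Local Open Scope ring_scope.

Lemma Psi_monic (m : nat) : (1 < m)%N -> Psi m \is monic.
Proof. by move=> m1; rewrite -(mk_monic_Psi m1) monic_mk_monic. Qed.

Lemma val_in_qpoly_Psi (m : nat) (p : {poly rat}) : (1 < m)%N ->
  val (in_qpoly (Psi m) p) = p %% Psi m.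
Proof.
by move=> m1; rewrite /= mk_monic_Psi // -Pdiv.IdomainMonic.modpE ?Psi_monic.
Qed.

(** The quotient ring multiplies by reducing the product of representatives, so the group laws can
    be checked in [{poly %/ Psi m}]. *)
Lemma mulmod_val (m : nat) (p q : {poly %/ Psi m}) : (1 < m)%N ->
  mulmod m (val p) (val q) = val (p * q).
Proof. by move=> m1; rewrite /mulmod -val_in_qpoly_Psi. Qed.

Lemma fpolyD (m : nat) (j k : int) : (1 < m)%N ->
  mulmod m (fpoly m j) (fpoly m k) = fpoly m (j + k).
Proof. by move=> m1; rewrite mulmod_val // -exprzDr ?unit_1subX // -opprD. Qed.

Lemma Psi_ndvd_1subX_expB1 (m n : nat) : (1 < m)%N -> (0 < n)%N ->
  ~~ (Psi m %| (1 - 'X) ^+ n - 1).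
Proof.
move=> m1 n0; pose PsiZ : {poly int} := \poly_(j < m) 1.
have PsiZ_Q : map_poly (intr : int -> rat) PsiZ = Psi m.
  by rewrite Psi_poly; apply/polyP=> i; rewrite coef_map !coef_poly; case: ifP.
have PsiZ_monic : PsiZ \is monic.
  case: m m1 @PsiZ {PsiZ_Q} => // m _ PsiZ.
  by rewrite monicE lead_coef_poly ?oner_eq0.
have -> : (1 - 'X) ^+ n - 1 =
    map_poly (intr : int -> rat) ((1 - 'X) ^+ n - 1 : {poly int}).
  by rewrite [RHS]rmorphB rmorphXn rmorphB /= map_polyX rmorph1.
rewrite -PsiZ_Q dvdp_rat_int.
(* By Gauss's lemma the quotient by the primitive part of [PsiZ] is integral; being monic, [PsiZ] is
   its own primitive part. *)
apply/negP=> /dvdpP_int[q]; rewrite zprimitive_monic //.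
move=> /(congr1 (fun p => p.[1])).
(* At 1 the power vanishes because [n > 0], which leaves [-1 = PsiZ.[1] * q.[1]]. *)
rewrite hornerM !hornerE subrr expr0n gtn_eqF //= sub0r => e.
have P1 : PsiZ.[1] = m%:Z.
  rewrite horner_poly (eq_bigr (fun=> 1)) => [|j _]; last by rewrite expr1n mulr1.
  by rewrite sumr_const card_ord -[RHS]natz.
have /dvdzP : exists r, (-1 : int) = r * m%:Z by exists q.[1]; rewrite mulrC -P1.
by rewrite dvdzE /= dvdn1 => /eqP mE; rewrite mE in m1.
Qed.

Lemma expr_1subX_neq1 (m n : nat) : (1 < m)%N -> (0 < n)%N ->
  in_qpoly (Psi m) (1 - 'X) ^+ n != 1.
Proof.
move=> m1 n0; apply: contraNneq (Psi_ndvd_1subX_expB1 _ _ m1 n0).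
rewrite -rmorphXn -(in_qpoly1 (Psi m)) => /eqP.
rewrite -subr_eq0 -rmorphB => /eqP/(congr1 val).
by rewrite val_in_qpoly_Psi // => /eqP.
Qed.

Lemma fpoly_inj (m : nat) : (1 < m)%N -> injective (fpoly m).
Proof.
move=> m1 j k /val_inj; set a := in_qpoly _ _ => ajk.
have ua : a \is a GRing.unit := unit_1subX m1.
have torsion (n : int) : a ^ n = 1 -> n = 0.
  case: n => [[//|n]|n] e; have := expr_1subX_neq1 _ _ m1 (ltn0Sn n); rewrite -/a.
    by rewrite exprnP e eqxx.
  (* A negative exponent becomes a positive one on inverting both sides. *)
  by move: e; rewrite NegzE -exprnN => /(canRL (@invrK _)) ->; rewrite invr1 eqxx.
apply/eqP; rewrite -subr_eq0; apply/eqP/torsion.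
(* [a ^ (j - k) = a ^ (- k) * a ^ j = a ^ (- j) * a ^ j = 1]. *)
by rewrite addrC exprzDr // -ajk -exprzDr // addNr.
Qed.

Theorem mainTheorem5 (m : nat) (hm : (2 <= m)%N) :
  infinite_set (Gset m) /\ abelian_group_on (Gset m) (mulmod m).
Proof.
split.
  (* The natural exponents already embed [nat] into [Gset m]. *)
  have natG : (range (fun n : nat => fpoly m n) `<=` Gset m)%classic.
    by move=> _ [n _ <-]; exists (n : int).
  have inj : set_inj setT (fun n : nat => fpoly m n).
    by apply: in2W => i j /(fpoly_inj _ hm) [].
  apply: (sub_infinite_set natG); rewrite (eq_finite_set (inj_card_eq inj)).
  exact: infinite_nat.
split.
- by move=> _ _ [j _ <-] [k _ <-]; exists (j + k); rewrite ?fpolyD.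
- by move=> _ _ _ [i _ <-] [j _ <-] [k _ <-]; rewrite !fpolyD // addrA.
- exists (fpoly m 0); split; first by exists 0.
    by move=> _ [k _ <-]; rewrite !fpolyD // add0r addr0.
  move=> _ [k _ <-]; exists (fpoly m (- k)).
  by split; [exists (- k) | rewrite fpolyD ?subrr | rewrite fpolyD ?addNr].
- by move=> _ _ [j _ <-] [k _ <-]; rewrite !fpolyD // addrC.
Qed.
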